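(* For each integer $r>3$, there is no connected graph $H$ (possibly containing parallel edges) such that $H\prec G$ for every $r$-regular multigraph $G$.
   Context: Graphs are finite, undirected and loopless, and may contain parallel edges; a multigraph is such a graph, with parallel edges allowed. For a vertex $u$ of a graph $G$, $\partial_G u$ denotes the set of edges of $G$ incident to $u$. An $H$-colouring of $G$ is a map $f:E(G)\to E(H)$ that is a proper edge-colouring (adjacent edges of $G$ receive distinct edges of $H$) such that for every $u\in V(G)$ there exists $v\in V(H)$ with $f(\partial_G u)=\partial_H v$. We write $H\prec G$ ($H$ colours $G$) if $G$ admits an $H$-colouring. *)

(* Defs.v *)
From mathcomp Require Import all_boot.

Set Implicit Arguments.
Unset Strict Implicit.
Unset Printing Implicit Defensive.

(* Finite undirected loopless graphs. Edges form a type of their own, so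
   several edges may have the same ends; requiring two distinct ends excludes
   loops. *)
Record mgraph := MGraph {
  vert : finType;
  edge : finType;
  ends : edge -> {set vert};
  card_ends : forall e, #|ends e| = 2
}.

Definition incident (G : mgraph) (u : vert G) : {set edge G} :=
  [set e | u \in ends e].

Definition regular (r : nat) (G : mgraph) : Prop :=
  forall u : vert G, #|incident u| = r.

Definition adjacent (G : mgraph) : rel (vert G) :=
  fun x y => [exists e : edge G, ends e == [set x; y]].

(* The graph with no vertices counts as connected here. *)
Definition connected (G : mgraph) : Prop :=
  forall x y : vert G, connect (@adjacent G) x y.

(* Distinct parallel edges are adjacent. *)
Definition adjacent_edges (G : mgraph) : rel (edge G) :=
  fun e e' => (e != e') && (ends e :&: ends e' != set0).

Definition proper_edge_colouring (G : mgraph) (C : Type)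
    (f : edge G -> C) : Prop :=
  forall e e' : edge G, adjacent_edges e e' -> f e <> f e'.

Definition colouring (H G : mgraph) (f : edge G -> edge H) : Prop :=
  proper_edge_colouring f /\
  forall u : vert G, exists v : vert H, f @: incident u = incident v.

(* H colours G, i.e. $H \prec G$. *)
Definition colours (H G : mgraph) : Prop :=
  exists f : edge G -> edge H, colouring f.

(* Main.v *)
(* For 2a + c = a + b = r, join r "blobs" (triangles x, y, z in which xy and xz
   have multiplicity a and yz has multiplicity b) to c hubs, each hub being
   joined by one edge to the vertex x of every blob. A colouring is injective on
   the edges of a triangle and, if c < b, maps a blob onto a blob with the same
   multiplicities. If c is r mod 2, then the image of the hub graph is closed
   under adjacency, so it is all of the connected graph H, and no two vertices
   of H are joined by more than b = ceil(r/2) edges. But taking c two larger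
   makes b one larger, and the image of a blob then contains two vertices joined
   by ceil(r/2) + 1 edges. *)
Require Import Defs.
From mathcomp Require Import all_boot.
From mathcomp Require Import zify.

Set Implicit Arguments.
Unset Strict Implicit.
Unset Printing Implicit Defensive.

(** * Edges and their ends *)

Lemma incident3 (G : mgraph) (u v w : vert G) (e : edge G) :
  e \in incident u -> e \in incident v -> e \in incident w ->
  u != v -> v != w -> u != w -> False.
Proof.
rewrite !inE => eu ev ew uv vw uw.
have /subset_leq_card : [set u; v; w] \subset ends e.
  by apply/subsetP => t; rewrite !inE => /orP[/orP[]|] /eqP ->.
rewrite card_ends setUC cardsU1 cards2 !inE uv negb_or.
by rewrite (eq_sym w) uw (eq_sym w) vw.
Qed.

Lemma connected_closed (G : mgraph) (S : {pred vert G}) (v : vert G) :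
  connected G -> v \in S ->
  (forall u w e, u \in S -> e \in incident u -> e \in incident w -> w \in S) ->
  forall w, w \in S.
Proof.
move=> connG vS closS w; have /connectP[p + ->] := connG v w.
elim: p v vS => //= u p IHp v vS /andP[/existsP[e /eqP Ee]]; apply: IHp.
by apply: (closS v u e); rewrite // inE Ee !inE eqxx ?orbT.
Qed.

Lemma proper_inj (G : mgraph) (C : Type) (f : edge G -> C) (u : vert G) :
  proper_edge_colouring f -> {in incident u &, injective f}.
Proof.
move=> fP e e'; rewrite !inE => eu e'u fee'; apply/eqP/negPn/negP => ne.
apply: fP fee'; rewrite /adjacent_edges ne; apply/set0Pn; exists u.
by rewrite inE eu.
Qed.

(** * Blobs and their images under a colouring *)

(** A triangle that edges can leave only at [x], stated without fixing the multiplicities. The final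
    inequality is what keeps [x] apart from [y] and [z] under a colouring. *)
Definition blob (G : mgraph) (x y z : vert G) : Prop :=
  [/\ [/\ x != y, y != z & x != z],
      incident y \subset incident x :|: incident z,
      incident z \subset incident x :|: incident y,
      incident x :&: incident y != set0 /\ incident x :&: incident z != set0
    & #|incident x :\: (incident y :|: incident z)|
      < #|incident y :&: incident z|].

Lemma blobC (G : mgraph) (x y z : vert G) : blob x y z -> blob x z y.
Proof.
case=> [[xy yz xz] sy sz [nxy nxz] lt].
by split; rewrite ?(eq_sym z) // (setUC (incident z)) (setIC (incident z)).
Qed.

Definition vertex_map (H G : mgraph) (f : edge G -> edge H)
    (phi : vert G -> vert H) : Prop :=
  forall u, f @: incident u = incident (phi u).

Lemma vertex_map_ex (H G : mgraph) (f : edge G -> edge H) :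
  colouring f -> exists phi, vertex_map f phi.
Proof. by case=> _ /fin_all_exists. Qed.

(** Otherwise the colour of an edge xy occurs at [z] too, on an edge that also meets [x] or [y].
    Properness makes the two edges equal, and this edge has three ends. *)
Lemma blob_image_neq_yz (H G : mgraph) (f : edge G -> edge H)
    (phi : vert G -> vert H) (x y z : vert G) :
  proper_edge_colouring f -> vertex_map f phi -> blob x y z -> phi y != phi z.
Proof.
move=> fP fphi [[xy yz xz] _ /subsetP sz [/set0Pn[e /setIP[ex ey]] _] _].
apply/eqP => Ephi.
have: f e \in f @: incident z by rewrite fphi -Ephi -fphi imset_f.
case/imsetP => e' e'z fee'.
have Eee' : e = e'.
  by have /setUP[e'x|e'y] := sz _ e'z; [apply: (proper_inj fP ex)
    | apply: (proper_inj fP ey)].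
by apply: (incident3 ex ey _ xy yz xz); rewrite Eee'.
Qed.

(** Otherwise every colour of an edge yz occurs at [x]. By properness the edge carrying it there
    avoids [y] and [z], so it leaves the blob, and there are too few such edges. *)
Lemma blob_image_neq_xy (H G : mgraph) (f : edge G -> edge H)
    (phi : vert G -> vert H) (x y z : vert G) :
  proper_edge_colouring f -> vertex_map f phi -> blob x y z -> phi x != phi y.
Proof.
move=> fP fphi [[xy yz xz] _ _ _ lt]; apply/eqP => Ephi.
move: lt; rewrite ltnNge => /negP; apply.
rewrite -(card_in_imset (f := f)) => [|e e' /setIP[ey _] /setIP[e'y _]];
  last first.
  exact: (proper_inj fP ey).
apply: leq_trans (leq_imset_card f _).
apply/subset_leq_card/subsetP => _ /imsetP[e eyz ->].
have [ey ez] := setIP eyz.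
have: f e \in f @: incident x by rewrite fphi Ephi -fphi imset_f.
case/imsetP => e' e'x fee'; rewrite fee' imset_f // in_setD in_setU.
rewrite e'x andbT; apply/negP => /orP e'yz.
have Eee' : e = e'.
  by case: e'yz => ?; [apply: (proper_inj fP ey) | apply: (proper_inj fP ez)].
by apply: (incident3 _ ey ez xy yz xz); rewrite Eee'.
Qed.

(* The edges of a triangle are pairwise adjacent, so a colouring is injective
   on them and cannot fold a blob. *)
Lemma blob_image (H G : mgraph) (f : edge G -> edge H)
    (phi : vert G -> vert H) (x y z : vert G) :
  proper_edge_colouring f -> vertex_map f phi -> blob x y z ->
  [/\ [/\ phi x != phi y, phi y != phi z & phi x != phi z],
      incident (phi x) :&: incident (phi y) = f @: (incident x :&: incident y),
      incident (phi x) :&: incident (phi z) = f @: (incident x :&: incident z)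
    & incident (phi y) :&: incident (phi z) = f @: (incident y :&: incident z)].
Proof.
move=> fP fphi B; have B' := blobC B.
have XY := blob_image_neq_xy fP fphi B.
have XZ := blob_image_neq_xy fP fphi B'.
have YZ := blob_image_neq_yz fP fphi B.
have sub u v : f @: (incident u :&: incident v)
    \subset incident (phi u) :&: incident (phi v).
  by rewrite -!fphi subsetI !imsetS ?subsetIl ?subsetIr.
have mem u e : e \in incident u -> f e \in incident (phi u).
  by rewrite -fphi; apply: imset_f.
case: B => [_ /subsetP sy /subsetP sz _ _].
(* For the reverse inclusions, a shared colour comes from an edge at [y] or [z], hence from one
   inside the triangle. If that edge joined the wrong pair, its image would have three ends. *)
split=> //; apply/eqP; rewrite eqEsubset sub andbT; apply/subsetP => h.
- case/setIP => hX; rewrite -{1}fphi => /imsetP[e ey Eh]; subst h.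
  have /setUP[ex|ez] := sy _ ey; first by rewrite imset_f // inE ex.
  by case: (incident3 hX (mem _ _ ey) (mem _ _ ez)).
- case/setIP => hX; rewrite -{1}fphi => /imsetP[e ez Eh]; subst h.
  have /setUP[ex|ey] := sz _ ez; first by rewrite imset_f // inE ex.
  by case: (incident3 hX (mem _ _ ey) (mem _ _ ez)).
- rewrite setIC => /setIP[hZ]; rewrite -{1}fphi => /imsetP[e ey Eh]; subst h.
  have /setUP[ex|ez] := sy _ ey; last by rewrite imset_f // inE ey.
  by case: (incident3 (mem _ _ ex) (mem _ _ ey) hZ).
Qed.

Lemma card_image_between (H G : mgraph) (f : edge G -> edge H) (u v : vert G) :
  proper_edge_colouring f ->
  #|f @: (incident u :&: incident v)| = #|incident u :&: incident v|.
Proof.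
move=> fP; apply: card_in_imset => e e' /setIP[eu _] /setIP[e'u _].
exact: proper_inj fP _ _ eu e'u.
Qed.

(** * The hub graphs and their edge counts *)

(* [inl j] is a hub; [inr (i, None)], [inr (i, Some true)] and
   [inr (i, Some false)] are the vertices x, y, z of the i-th blob. *)
Definition hub_vert (r c : nat) : finType := ('I_c + 'I_r * option bool)%type.

Definition hub_edge (r a b c : nat) : finType :=
  ('I_r * ('I_c + (bool * 'I_a + 'I_b)))%type.

Definition hub_ends (r a b c : nat) (e : hub_edge r a b c) :
    {set hub_vert r c} :=
  let: (i, t) := e in
  match t with
  | inl j => [set inl j; inr (i, None)]
  | inr (inl (s, _)) => [set inr (i, None); inr (i, Some s)]
  | inr (inr _) => [set inr (i, Some true); inr (i, Some false)]
  end.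

Lemma card_hub_ends (r a b c : nat) (e : hub_edge r a b c) :
  #|hub_ends e| = 2.
Proof.
by case: e => i [j|[[s k]|k]]; rewrite cards2 //= (inj_eq inr_inj) xpair_eqE eqxx.
Qed.

Definition hub_graph (r a b c : nat) : mgraph := MGraph (@card_hub_ends r a b c).

(** Makes incidence compute on constructors, for the counts below. *)
Lemma incident_hub (r a b c : nat) (u : vert (hub_graph r a b c))
    (e : edge (hub_graph r a b c)) :
  (e \in incident u) =
  match u, e.2 with
  | inl j, inl j' => j' == j
  | inr (i, None), inl _ => e.1 == i
  | inr (i, None), inr (inl _) => e.1 == i
  | inr (i, Some s), inr (inl (s', _)) => (e.1 == i) && (s' == s)
  | inr (i, Some s), inr (inr _) => e.1 == i
  | _, _ => false
  end.
Proof.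
rewrite inE; case: e u => i [j'|[[s' k]|k]] [j|[i' [s|]]]; rewrite /= !inE //=.
all: rewrite ?(inj_eq inl_inj) ?(inj_eq inr_inj) ?xpair_eqE ?orbF ?andbF ?andbT //=.
- by rewrite eq_sym (inj_eq Some_inj) (eq_sym s).
- by rewrite orbF eq_sym.
- by rewrite -andb_orr !(inj_eq Some_inj) eq_sym; case: s; rewrite andbT.
Qed.

(** Here and in the next counts, the edge set is the image of an index type of known size under an
    explicit injection [g]. *)
Lemma card_hub_hub (r a b c : nat) (j : 'I_c) :
  #|incident (inl j : vert (hub_graph r a b c))| = r.
Proof.
pose g (i : 'I_r) : hub_edge r a b c := (i, inl j).
have g_inj : injective g by move=> i i' [].
rewrite -[RHS]card_ord -(card_imset _ g_inj).
apply: eq_card => -[i t]; rewrite incident_hub /=; apply/idP/imsetP.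
  by case: t => // j' /eqP ->; exists i.
by case=> i' _ [_ ->].
Qed.

Lemma card_hub_x (r a b c : nat) (i : 'I_r) :
  #|incident (inr (i, None) : vert (hub_graph r a b c))| = c + 2 * a.
Proof.
pose g (t : 'I_c + bool * 'I_a) : hub_edge r a b c :=
  (i, match t with inl j => inl j | inr p => inr (inl p) end).
have g_inj : injective g by move=> [j|p] [j'|p'] // [->].
rewrite -[in RHS](card_ord c) -card_bool -[in RHS](card_ord a) -card_prod -card_sum.
rewrite -(card_imset _ g_inj); apply: eq_card => -[i' t].
rewrite incident_hub; apply/idP/imsetP => /=.
  by case: t => [j|[p|//]] /eqP ->; [exists (inl j) | exists (inr p)].
by case=> [[j|p]] _ [-> ->] /=.
Qed.

Lemma card_hub_yz (r a b c : nat) (i : 'I_r) (s : bool) :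
  #|incident (inr (i, Some s) : vert (hub_graph r a b c))| = a + b.
Proof.
pose g (t : 'I_a + 'I_b) : hub_edge r a b c :=
  (i, match t with inl k => inr (inl (s, k)) | inr k => inr (inr k) end).
have g_inj : injective g by move=> [j|p] [j'|p'] // [->].
rewrite -[in RHS](card_ord a) -[in RHS](card_ord b) -card_sum.
rewrite -(card_imset _ g_inj); apply: eq_card => -[i' t].
rewrite incident_hub; apply/idP/imsetP => /=.
  case: t => [j|[[s' k]|k]] //.
    by case/andP => /eqP -> /eqP ->; exists (inl k).
  by move=> /eqP ->; exists (inr k).
by case=> [[j|p]] _ [-> ->] /=; rewrite ?eqxx.
Qed.

Lemma card_hub_between_x (r a b c : nat) (i : 'I_r) (s : bool) :
  #|incident (inr (i, None) : vert (hub_graph r a b c))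
    :&: incident (inr (i, Some s) : vert (hub_graph r a b c))| = a.
Proof.
pose g (k : 'I_a) : hub_edge r a b c := (i, inr (inl (s, k))).
have g_inj : injective g by move=> k k' [].
rewrite -[RHS]card_ord -(card_imset _ g_inj).
apply: eq_card => -[i' t]; rewrite inE !incident_hub /=; apply/idP/imsetP.
  by case: t => [j|[[s' k]|k]]; rewrite ?andbF // => /and3P[_ /eqP -> /eqP ->]; exists k.
by case=> k _ [-> ->]; rewrite !eqxx.
Qed.

Lemma card_hub_between_yz (r a b c : nat) (i : 'I_r) (s : bool) :
  #|incident (inr (i, Some s) : vert (hub_graph r a b c))
    :&: incident (inr (i, Some (~~ s)) : vert (hub_graph r a b c))| = b.
Proof.
pose g (k : 'I_b) : hub_edge r a b c := (i, inr (inr k)).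
have g_inj : injective g by move=> k k' [].
rewrite -[RHS]card_ord -(card_imset _ g_inj).
apply: eq_card => -[i' t]; rewrite inE !incident_hub /=; apply/idP/imsetP.
  case: t => [j|[[s' k]|k]] //; last by case/andP => /eqP ->; exists k.
  by case/andP => /andP[_ /eqP ->] /andP[_]; case: s.
by case=> k _ [-> ->]; rewrite !eqxx.
Qed.

Lemma card_hub_ext (r a b c : nat) (i : 'I_r) (s : bool) :
  #|incident (inr (i, None) : vert (hub_graph r a b c))
    :\: (incident (inr (i, Some s) : vert (hub_graph r a b c))
         :|: incident (inr (i, Some (~~ s)) : vert (hub_graph r a b c)))| = c.
Proof.
pose g (j : 'I_c) : hub_edge r a b c := (i, inl j).
have g_inj : injective g by move=> k k' [].
rewrite -[RHS]card_ord -(card_imset _ g_inj).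
apply: eq_card => -[i' t]; rewrite in_setD in_setU !incident_hub /=.
apply/idP/imsetP.
  case: t => [j|[[s' k]|k]]; rewrite ?andbF //; first by move=> /eqP ->; exists j.
  by case: eqP => //; case: s s' => -[].
by case=> j _ [-> ->] /=; rewrite eqxx.
Qed.

Lemma hub_blob (r a b c : nat) (i : 'I_r) (s : bool) : 0 < a -> c < b ->
  blob (inr (i, None) : vert (hub_graph r a b c)) (inr (i, Some s))
       (inr (i, Some (~~ s))).
Proof.
move=> a_gt0 ltcb; split; last by rewrite card_hub_ext card_hub_between_yz.
- by rewrite !(inj_eq inr_inj) !xpair_eqE !eqxx; case: s.
- apply/subsetP => -[i' t]; rewrite in_setU !incident_hub /=.
  by case: t => [//|[[s' k]|k]] => [/andP[-> _]|->]; rewrite ?orbT.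
- apply/subsetP => -[i' t]; rewrite in_setU !incident_hub /=.
  by case: t => [//|[[s' k]|k]] => [/andP[-> _]|->]; rewrite ?orbT.
- by rewrite -!card_gt0 !card_hub_between_x.
Qed.

Lemma hub_regular (r a b c : nat) :
  c + 2 * a = r -> a + b = r -> regular r (hub_graph r a b c).
Proof.
move=> Er1 Er2 [j|[i [s|]]].
- exact: card_hub_hub.
- by rewrite card_hub_yz.
- by rewrite card_hub_x.
Qed.

(** * The image of a hub graph with at most one hub *)

Lemma incident_parallel (G : mgraph) (u w v : vert G) (h h' : edge G) :
  u != w -> h \in incident u :&: incident w ->
  h' \in incident u :&: incident w -> h \in incident v -> h' \in incident v.
Proof.
move=> uw /setIP[hu hw] /setIP[h'u h'w] hv.
have [<-//|uv] := eqVneq u v; have [<-//|wv] := eqVneq w v.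
by case: (incident3 hu hw hv).
Qed.

Section HubImage.
Variables (H : mgraph) (r a b c : nat).
Local Notation G := (hub_graph r a b c).
Variables (f : edge G -> edge H) (phi : vert G -> vert H).
Hypotheses (fP : proper_edge_colouring f) (fphi : vertex_map f phi).
Hypotheses (r_gt1 : 1 < r) (a_gt1 : 1 < a) (lt_cb : c < b) (c_le1 : c <= 1).

Let U (j : 'I_c) : vert H := phi (inl j : vert G).
Let X (i : 'I_r) : vert H := phi (inr (i, None) : vert G).
Let Y (i : 'I_r) (s : bool) : vert H := phi (inr (i, Some s) : vert G).
Let g (i : 'I_r) (j : 'I_c) : edge G := (i, inl j).

Let image_blob i s := blob_image fP fphi (hub_blob i s (ltnW a_gt1) lt_cb).

Let neqXY i s : X i != Y i s.
Proof. by have [[]] := image_blob i s. Qed.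

Let neqYY i s : Y i s != Y i (~~ s).
Proof. by have [[]] := image_blob i s. Qed.

Let card_XY i s : #|incident (X i) :&: incident (Y i s)| = a.
Proof.
have [_ -> _ _] := image_blob i s.
by rewrite card_image_between // card_hub_between_x.
Qed.

Let card_YY i s : #|incident (Y i s) :&: incident (Y i (~~ s))| = b.
Proof.
have [_ _ _ ->] := image_blob i s.
by rewrite card_image_between // card_hub_between_yz.
Qed.

Let mem_image u e : e \in incident u -> f e \in incident (phi u).
Proof. by rewrite -fphi; apply: imset_f. Qed.

Let hub_unique (j j' : 'I_c) : j = j'.
Proof. by apply: val_inj => /=; have := ltn_ord j; have := ltn_ord j'; lia. Qed.

Let gX i j : f (g i j) \in incident (X i).
Proof. by apply: mem_image; rewrite incident_hub /=. Qed.

Let gU i j : f (g i j) \in incident (U j).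
Proof. by apply: mem_image; rewrite incident_hub /=. Qed.

(** By [blob_image], a colour at both [X i] and [Y i s] comes from an edge xy of the blob. The
    colouring is injective at x, so that edge would be [g i j], which does not meet y. *)
Let gY i j s : f (g i j) \notin incident (Y i s).
Proof.
apply/negP => gYi; have [_ EXY _ _] := image_blob i s.
have: f (g i j) \in incident (X i) :&: incident (Y i s) by rewrite inE gX.
rewrite EXY => /imsetP[e /setIP[ex ey]].
have gx : g i j \in incident (inr (i, None) : vert G).
  by rewrite incident_hub /=.
move/(proper_inj fP gx ex) => Ee.
by move: ey; rewrite -Ee incident_hub.
Qed.

Let mem_X i h : h \in incident (X i) ->
  (exists s, h \in incident (Y i s)) \/ exists j, h = f (g i j).
Proof.
rewrite -fphi => /imsetP[[i' [j|[[s k]|k]]]]; rewrite incident_hub //= => /eqP -> ->.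
  by right; exists j.
by left; exists s; apply: mem_image; rewrite incident_hub /= !eqxx.
Qed.

Let mem_Y i s h : h \in incident (Y i s) ->
  h \in incident (X i) \/ h \in incident (Y i (~~ s)).
Proof.
rewrite -fphi => /imsetP[[i' [j|[[s' k]|k]]]]; rewrite incident_hub //=.
  by case/andP => /eqP -> /eqP -> ->; left; apply: mem_image; rewrite incident_hub /=.
by move=> /eqP -> ->; right; apply: mem_image; rewrite incident_hub /=.
Qed.

(* Otherwise an edge from the hub to another blob i' is sent to an edge of the
   triangle of the blob i, which has a parallel edge, whereas the only edge at
   X i' that does not lie in its blob has none. *)
Let neqUX i j : U j != X i.
Proof.
apply/eqP => EUX.
have [i' ne_i'i] : exists i' : 'I_r, i' != i.
  have : 0 < #|predC1 i| by rewrite cardC1 card_ord -ltnS prednK // ltnW.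
  by case/card_gt0P => i'; exists i'.
have ghX : f (g i' j) \in incident (X i) by rewrite -EUX gU.
(* Two edges at the hub cannot share a colour, so the image edge lies in the triangle of blob
   [i]. *)
have [[s hY]|[j' Eg]] := mem_X ghX; last first.
  have gU_src k : g k j \in incident (inl j : vert G) by rewrite incident_hub /=.
  rewrite (hub_unique j' j) in Eg.
  by have [Ei] := proper_inj fP (gU_src i') (gU_src i) Eg; rewrite Ei eqxx in ne_i'i.
have hXY : f (g i' j) \in incident (X i) :&: incident (Y i s) by rewrite inE ghX.
have [h' h'XY ne_h'] : exists2 h', h' \in incident (X i) :&: incident (Y i s)
    & h' != f (g i' j).
  have := card_XY i s; rewrite (cardsD1 (f (g i' j))) hXY => Ea.
  have /card_gt0P[h'] : 0 < #|(incident (X i) :&: incident (Y i s)) :\ f (g i' j)|.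
    by move: a_gt1; rewrite -Ea.
  by rewrite in_setD1 => /andP[? ?]; exists h'.
have h'X : h' \in incident (X i').
  exact: incident_parallel (neqXY i s) hXY h'XY (gX i' j).
have [[s' h'Y]|[j' Eh']] := mem_X h'X.
  have := incident_parallel (neqXY i s) h'XY hXY h'Y.
  by apply/negP; apply: gY.
by rewrite Eh' (hub_unique j' j) eqxx in ne_h'.
Qed.

Let adjacent_in_image t t' w h : phi t != phi t' ->
  h \in incident (phi t) -> h \in incident (phi t') -> h \in incident w ->
  w \in codom phi.
Proof.
move=> ne ht ht' hw; have [<-|nt] := eqVneq (phi t) w; first exact: codom_f.
have [<-|nt'] := eqVneq (phi t') w; first exact: codom_f.
by case: (incident3 ht ht' hw).
Qed.

(** Every edge of [H] at an image vertex joins it to a different image vertex: it comes either from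
    a triangle or from a hub edge. Since an edge has only two ends, the image is closed under
    adjacency. *)
Lemma hub_image_onto : connected H -> forall w, w \in codom phi.
Proof.
move=> connH; pose i0 := Ordinal (ltnW r_gt1).
apply: (connected_closed connH (codom_f phi (inr (i0, None) : vert G))).
move=> _ w h /codomP[t ->]; case: t => [j|[i [s|]]] ht hw.
- move: (ht); rewrite -fphi => /imsetP[[i [j'|[[s k]|k]]]]; rewrite incident_hub //=.
  move=> /eqP -> Eh; apply: (adjacent_in_image (neqUX i j)) hw; first exact: ht.
  by rewrite Eh; apply: gX.
- have [hX|hY] := mem_Y ht; first exact: adjacent_in_image (neqXY i s) hX ht hw.
  exact: adjacent_in_image (neqYY i s) ht hY hw.
- have [[s hY]|[j Eh]] := mem_X ht.
    exact: adjacent_in_image (neqXY i s) ht hY hw.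
  by apply: (adjacent_in_image (neqUX i j)) ht hw; rewrite Eh; apply: gU.
Qed.

Let between_blob_le (p : 'I_r * option bool) w : a <= b ->
  phi (inr p) != w -> #|incident (phi (inr p)) :&: incident w| <= b.
Proof.
move=> le_ab; case: p => i [s|] ne.
  have [->|[h /setIP[hY hw]]] := set_0Vmem (incident (phi (inr (i, Some s))) :&: incident w).
    by rewrite cards0.
  have [hX|hY'] := mem_Y hY.
    have [<-|neX] := eqVneq (X i) w; first by rewrite setIC card_XY.
    by case: (incident3 hX hY hw (neqXY i s) ne neX).
  have [<-|neY] := eqVneq (Y i (~~ s)) w; first by rewrite card_YY.
  by case: (incident3 hY hY' hw (neqYY i s) neY ne).
have [/existsP[s /eqP <-]|/existsPn neY] := boolP [exists s, Y i s == w].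
  by rewrite card_XY.
(* With [w] outside the triangle, only the image of the single possible hub edge can join [X i] to
   [w]. *)
apply: (@leq_trans 1); last by lia.
have E h : h \in incident (X i) :&: incident w -> exists j, h = f (g i j).
  case/setIP => hX hw; have [[s hY]|//] := mem_X hX.
  by case: (incident3 hX hY hw (neqXY i s) (neY s) ne).
apply/card_le1_eqP => h h' /E[j ->] /E[j' ->].
by rewrite (hub_unique j j').
Qed.

(** All vertices of [H] are images, and at most one is the image of a hub, so any two distinct ones
    include the image of a blob vertex. *)
Lemma hub_image_between_le : a <= b -> connected H ->
  forall v w : vert H, v != w -> #|incident v :&: incident w| <= b.
Proof.
move=> le_ab connH v w.
have /codomP[[j|p] ->] := hub_image_onto connH v; last exact: between_blob_le.
have /codomP[[j'|p] ->] := hub_image_onto connH w.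
  by rewrite (hub_unique j j') eqxx.
by rewrite eq_sym setIC; apply: between_blob_le.
Qed.

End HubImage.

(** * Comparing two hub graphs *)

Theorem theorem4p3 (r : nat) (hr : 3 < r) :
  ~ exists H : mgraph,
      connected H /\ forall G : mgraph, regular r G -> colours H G.
Proof.
move=> [H [connH colH]].
have r_half := odd_double_half r; rewrite -mul2n in r_half.
have r_uphalf := uphalf_half r.
have reg1 : regular r (hub_graph r r./2 (uphalf r) (odd r)).
  by apply: hub_regular; lia.
have reg2 : regular r (hub_graph r (r./2).-1 (uphalf r).+1 (2 + odd r)).
  by apply: hub_regular; lia.
have [f1 col1] := colH _ reg1; have [f2 col2] := colH _ reg2.
have [phi1 fphi1] := vertex_map_ex col1; have [phi2 fphi2] := vertex_map_ex col2.
have i0 : 'I_r by apply: (@Ordinal r 0); lia.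
(* Here [3 < r] matters: for r = 3 the multiplicity [(r./2).-1] is 0 and [2 + odd r] is not below
   [(uphalf r).+1]. *)
have B2 : blob (inr (i0, None) : vert (hub_graph r (r./2).-1 (uphalf r).+1 (2 + odd r)))
    (inr (i0, Some true)) (inr (i0, Some false)).
  by apply: (hub_blob i0 true); lia.
have [[_ YZ _] _ _ EYZ] := blob_image col2.1 fphi2 B2.
(* The first colouring bounds multiplicities in [H] by [uphalf r], but the second gives a pair of
   vertices joined by [(uphalf r).+1] edges. *)
have := hub_image_between_le col1.1 fphi1 _ _ _ _ _ connH YZ.
rewrite EYZ (card_image_between _ _ col2.1) (card_hub_between_yz _ _ _ _ true).
by move=> le_b; have := le_b ltac:(lia) ltac:(lia) ltac:(lia) ltac:(lia) ltac:(lia); lia.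
Qed.
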